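(* Let $V$ be a finite-dimensional Euclidean space and let $K \subseteq V$ be a proper, self-dual cone. Let $A \in L(V)$ be quasi-monotone (QM) with respect to $K$ and stable. Then for every invertible $E \in L(V)$ that acts diffusively on $K$, the mapping $EA$ is QM with respect to $K$ and stable.
   Context: $V$ is a finite-dimensional real vector space with inner product $\langle \cdot,\cdot\rangle$; $L(V)$ is the space of linear mappings from $V$ to $V$. A convex cone is a subset $K\subseteq V$ with $\alpha x+\beta y\in K$ for all $x,y\in K$ and $\alpha,\beta>0$. A proper cone is a convex cone that is closed, pointed ($K\cap(-K)=\{0\}$) and generating ($V=K-K$). $K$ is self-dual if $K=K^*$, where $K^*=\{y\in V:\langle x,y\rangle\ge 0 \text{ for all } x\in K\}$. $T\in L(V)$ is quasi-monotone (QM) with respect to $K$ if $x,y\in K$ and $\langle x,y\rangle=0$ imply $\langle x,Ty\rangle\ge 0$. $D\in L(V)$ acts diffusively on (with respect to) $K$ if $D(K)\subseteq K$, and $x,y\in K$ with $\langle x,y\rangle=0$ implies $\langle x,Dy\rangle=0$. $T\in L(V)$ is stable if all eigenvalues (real or complex) of $T$ have negative real part. *)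

(* Defs.v *)
From HB Require Import structures.
From mathcomp Require Import all_boot all_order all_algebra.
From mathcomp Require Import all_classical all_reals.
From mathcomp Require Import complex.

Set Implicit Arguments.
Unset Strict Implicit.
Unset Printing Implicit Defensive.

Import Order.TTheory GRing.Theory Num.Theory passmx.

Local Open Scope classical_set_scope.
Local Open Scope ring_scope.

Section Defs.
Variables (R : realType) (V : vectType R).

(* [{dot V for idfun}] is the type of symmetric, positive definite bilinear
   forms on [V], that is, of (real) inner products. *)
Variable dot : {dot V for idfun}.

Implicit Types (K : set V) (T : 'End(V)).

Definition dot_norm (x : V) : R := Num.sqrt (dot x x).

(* A [vectType] carries no topology; closedness is with respect to the metric
   of the Euclidean norm. *)
Definition dot_closed K : Prop :=
  forall x, (forall e : R, 0 < e -> exists2 y, K y & dot_norm (x - y) < e) ->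
    K x.

Definition convex_cone K : Prop :=
  forall (x y : V) (a b : R), K x -> K y -> 0 < a -> 0 < b ->
    K (a *: x + b *: y).

Definition pointed K : Prop := K `&` [set - x | x in K] = [set 0].

Definition generating K : Prop :=
  [set x - y | x in K & y in K] = [set: V].

Definition proper_cone K : Prop :=
  [/\ convex_cone K, dot_closed K, pointed K & generating K].

Definition dual_cone K : set V := [set y | forall x, K x -> 0 <= dot x y].

Definition self_dual K : Prop := K = dual_cone K.

Definition quasi_monotone K T : Prop :=
  forall x y, K x -> K y -> dot x y = 0 -> 0 <= dot x (T y).

Definition acts_diffusively K T : Prop :=
  T @` K `<=` K /\
  (forall x y, K x -> K y -> dot x y = 0 -> dot x (T y) = 0).

(* The eigenvalues in [R[i]] of a matrix of [T]. Both [mxof] and [eigenvalue]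
   use row vectors, so eigenvectors of the matrix are coordinates of
   eigenvectors of the complexification of [T]; see [complex_eigenvalueP]. *)
Definition complex_eigenvalue T (l : R[i]) : bool :=
  let e := vbasis {:V} in
  eigenvalue (map_mx (real_complex R) (mxof e e T)) l.

Definition stable T : Prop :=
  forall l : R[i], complex_eigenvalue T l -> complex.Re l < 0.

Lemma mulmx_real_complexP n (v : 'rV[R[i]]_n) (M : 'M[R]_n) (l : R[i]) :
  v *m map_mx (real_complex R) M = l *: v <->
  map_mx (@complex.Re R) v *m M =
    complex.Re l *: map_mx (@complex.Re R) v -
    complex.Im l *: map_mx (@complex.Im R) v /\
  map_mx (@complex.Im R) v *m M =
    complex.Im l *: map_mx (@complex.Re R) v +
    complex.Re l *: map_mx (@complex.Im R) v.
Proof.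
have entry j : (v *m map_mx (real_complex R) M) 0 j =
    Complex ((map_mx (@complex.Re R) v *m M) 0 j)
            ((map_mx (@complex.Im R) v *m M) 0 j).
  rewrite !mxE; apply/eqP; rewrite eq_complex /= !raddf_sum /=.
  by apply/andP; split; apply/eqP/eq_bigr => k _; rewrite !mxE;
    case: (v 0 k) => a b /=; rewrite mulr0 ?subr0 ?add0r.
have lv j : (l *: v) 0 j = Complex
    ((complex.Re l *: map_mx (@complex.Re R) v -
      complex.Im l *: map_mx (@complex.Im R) v) 0 j)
    ((complex.Im l *: map_mx (@complex.Re R) v +
      complex.Re l *: map_mx (@complex.Im R) v) 0 j).
  rewrite !mxE; case: l (v 0 j) => [a b] [c d] /=.
  by apply/eqP; rewrite eq_complex /= eqxx addrC eqxx.
split=> [/rowP eqv|[eR eI]].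
  by split; apply/rowP => j; have := eqv j; rewrite entry lv => -[].
by apply/rowP => j; rewrite entry lv eR eI.
Qed.

(* [u + i w] ranges over the complexification of [V]. *)
Lemma complex_eigenvalueP T (l : R[i]) :
  reflect
    (exists u w : V, [/\ (u, w) != (0, 0),
       T u = complex.Re l *: u - complex.Im l *: w &
       T w = complex.Im l *: u + complex.Re l *: w])
    (complex_eigenvalue T l).
Proof.
have eB := vbasisP {:V}.
apply: (iffP eigenvalueP) => [[v /mulmx_real_complexP[eR eI] v0]|[u [w [uw0 Tu Tw]]]].
  exists (vecof (vbasis {:V}) (map_mx (@complex.Re R) v)).
  exists (vecof (vbasis {:V}) (map_mx (@complex.Im R) v)).
  split; last 2 first.
  - by rewrite (hom_vecof _ eB) eR linearB !linearZ.
  - by rewrite (hom_vecof _ eB) eI linearD !linearZ.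
  apply: contra v0; rewrite xpair_eqE !vecof_eq0 //.
  case/andP => /eqP/rowP v0R /eqP/rowP v0I.
  apply/eqP/rowP => j; have := v0R j; have := v0I j; rewrite !mxE.
  by case: (v 0 j) => a b /= -> ->.
pose c := rVof (vbasis {:V}).
pose v : 'rV[R[i]]_(\dim {:V}) := \row_j Complex (c u 0 j) (c w 0 j).
have vR : map_mx (@complex.Re R) v = c u by apply/rowP => j; rewrite !mxE.
have vI : map_mx (@complex.Im R) v = c w by apply/rowP => j; rewrite !mxE.
exists v.
  apply/mulmx_real_complexP; rewrite vR vI -!(rVof_app _ eB) Tu Tw.
  by rewrite /c linearB linearD !linearZ.
apply: contra uw0 => /eqP v0.
rewrite xpair_eqE -!(rVof_eq0 eB) -/(c u) -/(c w) -vR -vI v0.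
by apply/andP; split; apply/eqP/rowP => j; rewrite !mxE.
Qed.

End Defs.

(* Main.v *)
Require Import Defs.
From HB Require Import structures.
From mathcomp Require Import all_boot all_order all_algebra.
From mathcomp Require Import all_classical all_reals.
From mathcomp Require Import topology normedtype derive complex.
From mathcomp Require Import ring lra.

Set Implicit Arguments.
Unset Strict Implicit.
Unset Printing Implicit Defensive.

Import Order.TTheory GRing.Theory Num.Theory passmx.
Import numFieldNormedType.Exports.

Local Open Scope classical_set_scope.
Local Open Scope ring_scope.

(** The adjoint of [E] preserves [K] and orthogonality of pairs in [K], so [E A]
    is quasi-monotone. For a quasi-monotone [A], stability is equivalent to the
    existence of [w] in the interior of [K] with [- A w] in the interior of [K].
    An invertible [E] with [E K] contained in [K] maps the interior of [K] into
    itself, so a witness [w] for [A] is also one for [E A]. *)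

(** * Inner products and adjoints *)

Section InnerProduct.
Variables (R : realType) (V : vectType R) (dot : {dot V for idfun}).
Implicit Types (x y z : V).

Lemma dot_sym x y : dot x y = dot y x.
Proof. by rewrite (hermC dot) expr0 mul1r. Qed.

Lemma dotDr z x y : dot z (x + y) = dot z x + dot z y.
Proof. exact: linearDr. Qed.

Lemma dotBr z x y : dot z (x - y) = dot z x - dot z y.
Proof. exact: linearBr. Qed.

Lemma dotZr z a x : dot z (a *: x) = a * dot z x.
Proof. exact: linearZr_LR. Qed.

Lemma dot0l z : dot 0 z = 0.
Proof. exact: linear0l. Qed.

Lemma dotDl z x y : dot (x + y) z = dot x z + dot y z.
Proof. exact: linearDl. Qed.

Lemma dotZl z a x : dot (a *: x) z = a * dot x z.
Proof. exact: linearZl_LR. Qed.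

Lemma dot_sumr z n (F : 'I_n -> V) : dot z (\sum_i F i) = \sum_i dot z (F i).
Proof. exact: linear_sumr. Qed.

Lemma dot_gt0 x : x != 0 -> 0 < dot x x.
Proof. exact: neq0_dnorm_gt0. Qed.

Lemma dot_basis_eq0 x :
  (forall i : 'I_(\dim {:V}), dot x (vbasis {:V})`_i = 0) -> x = 0.
Proof.
move=> x0; suff : dot x x = 0.
  by apply: contra_eq => /dot_gt0/lt0r_neq0.
rewrite {2}(coord_vbasis (memvf x)) dot_sumr big1 // => i _.
by rewrite dotZr x0 mulr0.
Qed.

(* The Gram operator [x |-> \sum_i <x, e_i> e_i] of a basis is injective,
   hence onto. *)
Lemma adjoint_exists (E : 'End(V)) z :
  exists z', forall y, dot z' y = dot z (E y).
Proof.
pose e := vbasis {:V}.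
pose gram x := \sum_(i < \dim {:V}) dot x e`_i *: e`_i.
have gram_lin : linear gram.
  move=> a x y; rewrite /gram scaler_sumr -big_split /=.
  by apply: eq_bigr => i _; rewrite dotDl dotZl scalerDl scalerA.
pose gramL := GRing.isLinear.Build R V V *:%R gram gram_lin.
pose G : {linear V -> V} := HB.pack gram gramL.
have fe : free e by have /andP[] := vbasisP {:V}.
have coordG x i : coord e i (gram x) = dot x e`_i by rewrite coord_sum_free.
have kerG : lker (linfun G) == 0%VS.
  apply/eqP/vspaceP => x; rewrite memv_ker memv0 lfunE.
  apply/eqP/eqP => [Gx|->]; last exact: linear0.
  by apply: dot_basis_eq0 => i; rewrite -coordG [gram x]Gx linear0.
exists ((linfun G)^-1%VF (\sum_(i < \dim {:V}) dot z (E e`_i) *: e`_i)) => y.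
set z' := (linfun G)^-1%VF _.
have dz' (i : 'I_(\dim {:V})) : dot z' e`_i = dot z (E e`_i).
  rewrite -coordG.
  have -> : gram z' = linfun G z' by rewrite lfunE.
  by rewrite lker0_lfunVK // coord_sum_free.
rewrite (coord_vbasis (memvf y)) (linear_sum E) !dot_sumr.
by apply: eq_bigr => i _; rewrite dotZr dz' -dotZr; congr (dot _ _); rewrite -linearZ.
Qed.

End InnerProduct.

(** * Self-dual cones and the maps acting on them *)

Section SelfDualCone.
Variables (R : realType) (V : vectType R) (dot : {dot V for idfun}).
Variable K : set V.
Hypothesis selfK : self_dual dot K.
Implicit Types (w x y z : V) (A B E : 'End(V)).

(* For a self-dual cone this is the topological interior. *)
Definition strictly_positive : set V :=
  [set w | forall z, K z -> z != 0 -> 0 < dot z w].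

Lemma self_dualP y : K y <-> (forall z, K z -> 0 <= dot z y).
Proof. by rewrite {1}selfK. Qed.

Lemma cone_dot_ge0 x y : K x -> K y -> 0 <= dot x y.
Proof. by move=> Kx /self_dualP; apply. Qed.

Lemma coneZ a x : 0 <= a -> K x -> K (a *: x).
Proof.
move=> a0 Kx; apply/self_dualP => z Kz.
by rewrite dotZr mulr_ge0 // cone_dot_ge0.
Qed.

Lemma strictly_positive_cone w : strictly_positive w -> K w.
Proof.
move=> w0; apply/self_dualP => z Kz.
by have [->|z0] := eqVneq z 0; [rewrite dot0l | exact/ltW/w0].
Qed.

Lemma strictly_positiveDZ w y a : strictly_positive w -> K y -> 0 < a ->
  strictly_positive (y + a *: w).
Proof.
move=> w0 Ky a0 z Kz z0; rewrite dotDr dotZr.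
by rewrite ltr_wpDl ?cone_dot_ge0 // mulr_gt0 // w0.
Qed.

Lemma cone_adjoint E z z' : E @` K `<=` K -> K z ->
  (forall y, dot z' y = dot z (E y)) -> K z'.
Proof.
move=> EK Kz zz'; apply/self_dualP => y Ky.
by rewrite dot_sym zz' cone_dot_ge0 //; apply: EK; exists y.
Qed.

Lemma quasi_monotone_comp A E : acts_diffusively dot K E ->
  quasi_monotone dot K A -> quasi_monotone dot K (E \o A)%VF.
Proof.
move=> [EK E0] qA x y Kx Ky xy0; rewrite lfunE /=.
have [x' xx'] := adjoint_exists dot E x.
by rewrite -xx' qA ?xx' ?E0 //; exact: cone_adjoint xx'.
Qed.

Lemma strictly_positive_image E w : bijective E -> E @` K `<=` K ->
  strictly_positive w -> strictly_positive (E w).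
Proof.
move=> [F _ FK] EK w0 z Kz z0; have [z' zz'] := adjoint_exists dot E z.
rewrite -zz' w0 //; first exact: cone_adjoint zz'.
(* If [z'] vanished, [z] would be orthogonal to the range of [E], which contains [z] because [E] is
   onto. *)
apply: contraL (dot_gt0 dot z0) => /eqP z'0.
by rewrite -{2}[z]FK -zz' z'0 dot0l ltxx.
Qed.

(** * Maxima over the cone by compactness, in coordinates *)

Let e := vbasis {:V}.

Lemma continuous_dot_vecof u : continuous (fun c => dot (vecof e c) u).
Proof.
have -> : (fun c => dot (vecof e c) u) =
    (fun c : 'rV[R]_(\dim {:V}) => \sum_i c 0 i * dot e`_i u).
  apply/funext => c; rewrite dot_sym dot_sumr.
  by apply: eq_bigr => i _; rewrite dotZr dot_sym.
move=> c; apply: (@cvg_big _ _ _ _ _ _ _ (nbhs c)) => [|i _].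
  exact: add_continuous.
by apply: (@cvgM _ _ (nbhs c)); [exact: coord_continuous | exact: cvg_cst].
Qed.

Lemma compact_cone_sphere :
  compact [set c : 'rV[R]_(\dim {:V}) | K (vecof e c) /\ `|c| = 1].
Proof.
apply: bounded_closed_compact.
  by exists 1; split => // M M1 c /= [_ ->]; exact: ltW.
(* Self-duality presents the cone as an intersection of closed half-spaces. *)
have -> : [set c : 'rV[R]_(\dim {:V}) | K (vecof e c) /\ `|c| = 1] =
  (\bigcap_(z in K) ((fun c => dot (vecof e c) z) @^-1` [set r | 0 <= r])) `&`
  ((fun c => `|c|) @^-1` [set 1]).
  apply/seteqP; split => c /= [Kc c1]; split => //.
    by move=> z Kz /=; rewrite dot_sym; exact: cone_dot_ge0.
  by apply/self_dualP => z Kz; rewrite dot_sym; exact: Kc.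
apply: closedI.
  apply: closed_bigI => z Kz; apply: preimage_closed => [c _|].
    exact: continuous_dot_vecof.
  exact: closed_ge.
apply: preimage_closed => [c _|]; first exact: norm_continuous.
exact: closed_eq.
Qed.

(** Invariance under positive scaling reduces the maximum over nonzero vectors of [K] to one over
    the compact unit sphere of the cone. *)
Lemma cone_max (f : V -> R) z0 :
  (forall c, K (vecof e c) -> c != 0 -> {for c, continuous (f \o vecof e)}) ->
  (forall a z, 0 < a -> f (a *: z) = f z) ->
  K z0 -> z0 != 0 ->
  exists z, [/\ K z, z != 0 & forall y, K y -> y != 0 -> f y <= f z].
Proof.
move=> fC fZ Kz0 z00; have eB := vbasisP {:V}.
pose S := [set c : 'rV[R]_(\dim {:V}) | K (vecof e c) /\ `|c| = 1].
have normalize y : K y -> y != 0 ->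
    exists2 c, S c & f (vecof e c) = f y.
  move=> Ky y0; pose c := rVof e y.
  have c0 : 0 < `|c| by rewrite normr_gt0 rVof_eq0.
  have cV : vecof e (`|c|^-1 *: c) = `|c|^-1 *: y by rewrite linearZ /= rVofK.
  exists (`|c|^-1 *: c); last by rewrite cV fZ // invr_gt0.
  split; first by rewrite cV; apply: coneZ => //; rewrite invr_ge0 ltW.
  by rewrite normrZ normfV normr_id mulVf // gt_eqF.
have S_neq0 c : S c -> c != 0.
  by move=> [_ c1]; rewrite -normr_eq0 c1 oner_eq0.
have S0 : S !=set0 by have [c Sc _] := normalize _ Kz0 z00; exists c.
have cS : {within S, continuous (f \o vecof e)}.
  apply: continuous_in_subspaceT => c /[!inE] Sc.
  by apply: fC; [case: Sc | exact: S_neq0].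
have [c /[!inE] Sc cmax] := compact_EVT_max S0 compact_cone_sphere cS.
exists (vecof e c); split; first by case: Sc.
  by rewrite vecof_eq0 //; exact: S_neq0.
move=> y Ky y0; have [c' Sc' <-] := normalize _ Ky y0.
by apply: cmax; rewrite inE.
Qed.

Lemma continuous_ratio w u c : strictly_positive w -> K (vecof e c) -> c != 0 ->
  {for c, continuous (fun c => dot (vecof e c) u / dot (vecof e c) w)}.
Proof.
move=> w0 Kc c0; apply: (@cvgM _ _ (nbhs c)).
  exact: continuous_dot_vecof.
apply: cvgV; last exact: continuous_dot_vecof.
by rewrite gt_eqF // w0 // vecof_eq0 //; exact: vbasisP.
Qed.

Lemma ratioZ w u a z : 0 < a ->
  dot (a *: z) u / dot (a *: z) w = dot z u / dot z w.
Proof. by move=> a0; rewrite !dotZl -mulf_div divff ?mul1r // gt_eqF. Qed.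

(** The maximal ratio is the least [s] with [s w - x] in [K]. By the choice of [s], the maximizer
    [z] is orthogonal to [s w - x], which gives a pair to which quasi-monotonicity applies. *)
Lemma cone_ratio_max w x z0 : strictly_positive w -> K z0 -> z0 != 0 ->
  exists z, [/\ K z, z != 0 & K ((dot z x / dot z w) *: w - x)].
Proof.
move=> w0 Kz0 z00.
have [c Kc c0|a z a0|z [Kz nz zmax]] :=
  @cone_max (fun z => dot z x / dot z w) z0 _ _ Kz0 z00.
- exact: continuous_ratio.
- exact: ratioZ.
exists z; split => //; apply/self_dualP => y Ky.
have [->|y0] := eqVneq y 0; first by rewrite dot0l.
by rewrite dotBr dotZr subr_ge0 -ler_pdivrMr ?zmax // w0.
Qed.

Lemma cone_order_unit w x : strictly_positive w ->
  exists2 s : R, 0 < s & K (s *: w - x).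
Proof.
move=> w0; have [[z0 [Kz0 z00]]|K0] := pselect (exists z, K z /\ z != 0).
  have [z [_ _ Kz]] := cone_ratio_max x w0 Kz0 z00.
  set s := dot z x / dot z w in Kz.
  exists (`|s| + 1); first by rewrite ltr_wpDl.
  apply/self_dualP => y Ky.
  have -> : (`|s| + 1) *: w - x = (s *: w - x) + (`|s| + 1 - s) *: w.
    by rewrite addrAC -scalerDl (addrC s) subrK.
  rewrite dotDr dotZr addr_ge0 ?cone_dot_ge0 // mulr_ge0 //.
    by rewrite subr_ge0 ler_wpDr // ler_norm.
  by rewrite cone_dot_ge0 //; exact: strictly_positive_cone.
(* Here [K] has no nonzero vector, so the dual condition is trivial. *)
exists 1 => //; apply/self_dualP => y Ky.
have [->|y0] := eqVneq y 0; first by rewrite dot0l.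
by case: K0; exists y.
Qed.

Lemma strictly_positive_perturb w x : strictly_positive w ->
  exists2 d : R, 0 < d &
    forall a, 0 <= a -> a <= d -> strictly_positive (w - a *: x).
Proof.
move=> w0; have [s s0 Ks] := cone_order_unit x w0.
(* If [a (s + 1) <= 1], then [<z, w - a x> >= (1 - a s) <z, w> >= a <z, w>], which is positive
   unless [a = 0]. *)
exists (s + 1)^-1 => [|a a0 ad z Kz z0]; first by rewrite invr_gt0 addr_gt0.
have := cone_dot_ge0 Kz Ks; have := w0 z Kz z0.
rewrite !dotBr !dotZr; set p := dot z w; set q := dot z x => p0 pq.
have as1 : a * (s + 1) <= 1 by rewrite -ler_pdivlMr ?div1r // addr_gt0.
have : 0 <= p * (1 - a * (s + 1)) by rewrite mulr_ge0 ?subr_ge0 // ltW.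
have : 0 <= a * (s * p - q) by rewrite mulr_ge0.
have [->|a_neq0] := eqVneq a 0; first by rewrite !mul0r !subr0 mulr1.
have : 0 < a * p by rewrite mulr_gt0 // lt_neqAle eq_sym a_neq0.
by lra.
Qed.

Lemma generating_strictly_positive : generating K ->
  exists w, strictly_positive w.
Proof.
move=> gK.
have /choice[x /choice[y xy]] (i : 'I_(\dim {:V})) :
    exists x y, [/\ K x, K y & x - y = e`_i].
  have : [set: V] e`_i by [].
  by rewrite -gK => -[x Kx [y Ky xy]]; exists x, y.
exists (\sum_i (x i + y i)) => z Kz z0; rewrite dot_sumr.
have xy0 i : 0 <= dot z (x i + y i).
  by have [Kx Ky _] := xy i; rewrite dotDr addr_ge0 ?cone_dot_ge0.
rewrite lt_neqAle sumr_ge0 // andbT eq_sym psumr_neq0 //.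
(* If every summand vanishes on [z], so do all [<z, x i>] and [<z, y i>], and [z] is orthogonal to
   the basis. *)
apply: contraNT z0 => /hasPn zxy; apply/eqP.
apply: (@dot_basis_eq0 _ _ dot) => i.
have [Kx Ky <-] := xy i.
have := zxy i (mem_index_enum i); rewrite /= dotDr dotBr.
have := cone_dot_ge0 Kz Kx; have := cone_dot_ge0 Kz Ky.
by rewrite -leNgt; lra.
Qed.

(** * Stability of quasi-monotone maps through interior vectors *)

(* Maximize [|<z, u + i v>| / <z, w>] over [z] in [K]. With [p, q] the
   coordinates and [s] the value of the maximum, the vector
   [s w - (p u + q v) / s] is in [K] and orthogonal to the maximizer, and the
   imaginary part of the eigenvalue cancels in the quasi-monotonicity
   inequality. *)
Lemma stable_strictly_positive B w : generating K -> quasi_monotone dot K B ->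
  strictly_positive w -> strictly_positive (- B w) -> stable B.
Proof.
move=> gK qB w0 Bw0 l /complex_eigenvalueP[u [v [uv0 Bu Bv]]].
rewrite ltNge; apply/negP => l0.
have [z0 [Kz0 z00]] : exists z, K z /\ z != 0.
  apply: contrapT => K0.
  have V0 x : x = 0.
    have : [set: V] x by [].
    rewrite -gK => -[y Ky [z Kz <-]].
    have [->|y0] := eqVneq y 0; last by case: K0; exists y.
    by have [->|z0] := eqVneq z 0; [rewrite subrr | case: K0; exists z].
  by move: uv0; rewrite (V0 u) (V0 v) eqxx.
pose f z := (dot z u / dot z w) ^+ 2 + (dot z v / dot z w) ^+ 2.
have [c Kc c0|a z a0|z [Kz nz zmax]] := @cone_max f z0 _ _ Kz0 z00.
- apply: (@cvgD _ _ _ (nbhs c)); apply: (@cvgM _ _ (nbhs c)); exact: continuous_ratio.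
- by rewrite /f !ratioZ.
have zw := w0 z Kz nz.
pose p := dot z u / dot z w; pose q := dot z v / dot z w.
have zu : dot z u = p * dot z w by rewrite /p divfK // gt_eqF.
have zv : dot z v = q * dot z w by rewrite /q divfK // gt_eqF.
(* The vector described above multiplied by [s], where [s ^+ 2 = p ^+ 2 + q ^+ 2]; this avoids the
   root and the division. *)
pose x := (p ^+ 2 + q ^+ 2) *: w - (p *: u + q *: v).
have Kx : K x.
  apply/self_dualP => y Ky.
  have [->|y0] := eqVneq y 0; first by rewrite dot0l.
  have yw := w0 y Ky y0; have := zmax y Ky y0; rewrite /f -/p -/q.
  have := divfK (lt0r_neq0 yw) (dot y u); have := divfK (lt0r_neq0 yw) (dot y v).
  rewrite /x dotBr dotDr !dotZr.
  set p' := dot y u / _; set q' := dot y v / _ => <- <- le.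
  move: p' q' le => p' q' le.
  rewrite !mulrA -mulrDl -mulrBl mulr_ge0 ?(ltW yw) //.
  (* Twice [p p' + q q'] is at most the sum of [p'^2 + q'^2] and [p^2 + q^2], and the former is at
     most the latter by maximality. *)
  have := sqr_ge0 (p - p'); have := sqr_ge0 (q - q').
  by nra.
have zx : dot z x = 0.
  by rewrite /x dotBr dotDr !dotZr zu zv; ring.
have Bx : B x = (p ^+ 2 + q ^+ 2) *: B w -
    (p *: (complex.Re l *: u - complex.Im l *: v) +
     q *: (complex.Im l *: u + complex.Re l *: v)).
  by rewrite /x linearB linearD !linearZ /= Bu Bv scalerN.
have := qB z x Kz Kx zx; rewrite Bx dotBr dotDr !dotZr dotBr dotDr !dotZr zu zv.
have : 0 < - dot z (B w) by have := Bw0 z Kz nz; rewrite linearNr.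
set r := complex.Re l in l0 *; set t := complex.Im l; move=> Bwz le.
(* A zero maximum would make [u] and [v] orthogonal to [K], which spans [V], so both would be
   zero. *)
have s0 : 0 < p ^+ 2 + q ^+ 2.
  have -> : p ^+ 2 + q ^+ 2 = f z by [].
  rewrite ltNge; apply: contra uv0 => fz.
  have K_eq0 y : K y -> dot y u = 0 /\ dot y v = 0.
    move=> Ky; have [->|y0] := eqVneq y 0; first by rewrite !dot0l.
    have yw := w0 y Ky y0; have := le_trans (zmax y Ky y0) fz.
    rewrite -(divfK (lt0r_neq0 yw) (dot y u)) -(divfK (lt0r_neq0 yw) (dot y v)).
    rewrite /f; set p' := dot y u / _; set q' := dot y v / _ => le0.
    have /andP[/eqP -> /eqP ->] : (p' == 0) && (q' == 0).
      rewrite -(sqrf_eq0 p') -(sqrf_eq0 q') -paddr_eq0 ?sqr_ge0 //.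
      by rewrite eq_le le0 addr_ge0 ?sqr_ge0.
    by rewrite mul0r.
  have eq0 (a : V) : (forall y, K y -> dot y a = 0) -> a = 0.
    move=> Ka; have aa : dot a a = 0.
      have : [set: V] a by [].
      rewrite -gK => -[y Ky [y' Ky' aE]]; rewrite -{2}aE dotBr.
      by rewrite ![dot a _]dot_sym !Ka // subrr.
    by apply: contra_eq aa => /(dot_gt0 dot)/lt0r_neq0.
  have u0 : u = 0 by apply: eq0 => y /K_eq0[].
  have v0 : v = 0 by apply: eq0 => y /K_eq0[].
  by rewrite xpair_eqE u0 v0 eqxx.
have : 0 <= (p ^+ 2 + q ^+ 2) * (dot z (B w) - r * dot z w).
  by apply: le_trans le _; rewrite le_eqVlt; apply/orP; left; apply/eqP; ring.
rewrite pmulr_rge0 // => h.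
have : 0 <= r * dot z w by rewrite mulr_ge0 // ltW.
by lra.
Qed.

(** If [x] is outside [K], the least [s] with [y = s w + x] in [K] is positive, and some nonzero [z]
    in [K] is orthogonal to [y]. Then [<z, t y - A y> > 0] by the hypotheses on [w] and [x], whereas
    quasi-monotonicity makes it at most [0]. *)
Lemma quasi_monotone_inverse_positive A t w x : quasi_monotone dot K A ->
  strictly_positive w -> strictly_positive (t *: w - A w) ->
  K (t *: x - A x) -> K x.
Proof.
move=> qA w0 Aw0 KAx; apply: contrapT => Kx.
have [z0 Kz0 z0x] : exists2 z, K z & dot z x < 0.
  apply: contrapT => nz; apply: Kx; apply/self_dualP => z Kz.
  by rewrite leNgt; apply/negP => zx; apply: nz; exists z.
have z00 : z0 != 0.
  by apply: contraTneq z0x => ->; rewrite dot0l ltxx.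
have [z [Kz nz]] := cone_ratio_max (- x) w0 Kz0 z00.
set s := _ / _; rewrite opprK => Ks.
have s0 : 0 < s.
  have := cone_dot_ge0 Kz0 Ks; rewrite dotDr dotZr.
  have := w0 _ Kz0 z00; nra.
have zs : dot z (s *: w + x) = 0.
  rewrite dotDr dotZr divfK; last by rewrite gt_eqF // w0.
  by rewrite linearNr addNr.
have AE : A (s *: w + x) = s *: A w + A x by rewrite linearD linearZ.
have := qA z _ Kz Ks zs; rewrite AE.
have := cone_dot_ge0 Kz KAx; have := mulr_gt0 s0 (Aw0 z Kz nz).
have : t * dot z (s *: w + x) = 0 by rewrite zs mulr0.
rewrite !dotBr !dotDr !dotZr; move: (s) => r.
by lra.
Qed.

(* The infimum of the [t >= 0] for which [w] and [t w - A w] are strictly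
   positive for some [w] is attained, because [t - A] is invertible there; it
   is then [0], because the condition is open in [t]. *)
Lemma stable_exists_strictly_positive A : generating K ->
  quasi_monotone dot K A -> stable A ->
  exists2 w, strictly_positive w & strictly_positive (- A w).
Proof.
move=> gK qA sA; have [w0 w0P] := generating_strictly_positive gK.
pose G := [set t : R | 0 <= t /\
  exists2 w, strictly_positive w & strictly_positive (t *: w - A w)].
have G0 : G !=set0.
  have [s s0 Ks] := cone_order_unit (A w0) w0P.
  (* The extra [1] adds [w0] to [s w0 - A w0], moving it from [K] into the interior. *)
  exists (s + 1); split; first by rewrite addr_ge0 ?ltW.
  exists w0 => //; rewrite scalerDl addrAC.
  exact: strictly_positiveDZ.
have lbG : lbound G 0 by move=> t [].
have hlG : has_lbound G by exists 0.
pose t := inf G; have t0 : 0 <= t by exact: lb_le_inf.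
have [w wE] : exists w, t *: w - A w = w0.
  pose T : 'End(V) := (t *: \1 - A)%VF.
  have TE x : T x = t *: x - A x.
    by rewrite /T add_lfunE opp_lfunE scale_lfunE id_lfunE.
  have kerT : lker T == 0%VS.
    apply/eqP/vspaceP => x; rewrite memv_ker memv0 TE subr_eq0.
    apply/eqP/eqP => [Ax|->]; last by rewrite !linear0.
    apply: contraTeq isT => x0.
    suff /sA : complex_eigenvalue A t%:C%C by rewrite /= ltNge t0.
    apply/complex_eigenvalueP; exists x, 0; rewrite /=.
    by rewrite xpair_eqE (negPf x0) !linear0 !scale0r !addr0 -Ax.
  by exists (T^-1%VF w0); rewrite -TE lker0_lfunVK.
have [d d0 dP] := strictly_positive_perturb (- w) w0P.
(* Inverse positivity is available at some [g] in [G] close to [t], where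
   [g w - A w = w0 + (g - t) w] is still interior. *)
have Kw : K w.
  have [g Gg gd] : exists2 g, G g & g < t + d.
    by apply: inf_lt => //; rewrite ltrDl.
  have tg : t <= g by exact: ge_inf.
  case: Gg => _ [w1 w1P Aw1].
  apply: (quasi_monotone_inverse_positive qA w1P Aw1).
  have -> : g *: w - A w = w0 - (g - t) *: - w.
    by rewrite -wE scalerN opprK scalerBl addrAC addrCA subrr addr0.
  by apply: strictly_positive_cone; apply: dP; lra.
(* If [<z, w> = 0], then [<z, w0> = - <z, A w> <= 0] by quasi-monotonicity. *)
have wP : strictly_positive w.
  move=> z Kz z0; rewrite lt_neqAle cone_dot_ge0 // andbT.
  apply: contraTneq (w0P z Kz z0) => /esym zw.
  by rewrite -leNgt -wE dotBr dotZr zw mulr0 sub0r oppr_le0 qA.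
have [d' d'0 d'P] := strictly_positive_perturb w w0P.
move: t0; rewrite le_eqVlt => /orP[/eqP t0|t0].
  by exists w => //; rewrite -[- A w]add0r -[X in X - _](scale0r w) t0 wE.
(* If [t > 0], the same [w] puts [t - m] in [G], below the infimum; [m <= t] keeps [t - m]
   nonnegative. *)
pose m := Num.min d' t.
have m0 : 0 < m by rewrite lt_min d'0 t0.
have : t <= t - m.
  apply: ge_inf => //; split; first by rewrite subr_ge0 ge_min lexx orbT.
  exists w => //.
  have -> : (t - m) *: w - A w = w0 - m *: w.
    by rewrite -wE scalerBl addrAC.
  by apply: d'P; [exact: ltW | rewrite ge_min lexx].
by rewrite lerBrDr gerDl leNgt m0.
Qed.

End SelfDualCone.

Theorem proposition3p6 (R : realType) (V : vectType R)
    (dot : {dot V for idfun}) (K : set V) (A : 'End(V)) :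
  proper_cone dot K -> self_dual dot K ->
  quasi_monotone dot K A -> stable A ->
  forall E : 'End(V), bijective E -> acts_diffusively dot K E ->
    quasi_monotone dot K (E \o A)%VF /\ stable (E \o A)%VF.
Proof.
move=> [_ _ _ gK] selfK qA sA E bE dE.
have qEA := quasi_monotone_comp selfK dE qA; split; first exact: qEA.
have [w wP Aw] := stable_exists_strictly_positive selfK gK qA sA.
apply: (stable_strictly_positive selfK gK qEA wP).
have -> : - (E \o A)%VF w = E (- A w) by rewrite lfunE /= linearN.
by case: dE => EK _; exact: strictly_positive_image bE EK Aw.
Qed.
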